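(* If $\mathcal{H}$ is a hypergraph on $n$ vertices which contains neither isolated vertices nor edges of size smaller than $3$, then $\gamma_g(\mathcal{H})\le \frac{5}{9}n$.
   Context: Hypergraphs are finite. Two distinct vertices are adjacent if some edge contains both; $N[v]$ is $v$ together with all vertices adjacent to $v$, and $N[S]=\bigcup_{v\in S}N[v]$. The domination game: Dominator and Staller alternately choose vertices $v_1,v_2,\dots$; with $D_i=\{v_1,\dots,v_i\}$, each chosen vertex must satisfy $N[v_i]\setminus N[D_{i-1}]\ne\emptyset$, and the game ends when $N[D_d]=V(\mathcal{H})$. Dominator aims to minimize the number of moves, Staller to maximize it. $\gamma_g(\mathcal{H})$ is the number of moves under optimal play when Dominator moves first. *)

(* Defs.v *)
From mathcomp Require Import all_boot.
Set Implicit Arguments. Unset Strict Implicit. Unset Printing Implicit Defensive.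

Section Domgame.
Variables (T : finType) (E : {set {set T}}).

Definition cnbhd (v : T) : {set T} :=
  [set u | (u == v) || [exists e in E, (v \in e) && (u \in e)]].

Definition cnbhd_set (S : {set T}) : {set T} := \bigcup_(v in S) cnbhd v.

Definition isolated (v : T) : Prop := forall u, u != v -> u \notin cnbhd v.

(* Value of the domination game under optimal play, from a position where the
   set of already dominated vertices is W = N[D_{i-1}], with Dominator to move
   iff [dom].  Legal moves are vertices v with N[v] \not\subset W.  The fuel k
   is #|T|, which suffices since every move dominates a new vertex. *)
Fixpoint game_value (k : nat) (dom : bool) (W : {set T}) : nat :=
  match k with
  | 0 => 0
  | k'.+1 =>
    if W == [set: T] then 0 else
    if dom then
      (\big[minn/#|T|.+1]_(v | ~~ (cnbhd v \subset W))
         game_value k' false (W :|: cnbhd v)).+1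
    else
      (\max_(v | ~~ (cnbhd v \subset W))
         game_value k' true (W :|: cnbhd v)).+1
  end.

Definition game_domination_number : nat := game_value #|T| true set0.

End Domgame.

(* Main.v *)
Require Import Defs.
From mathcomp Require Import all_boot.
From mathcomp Require Import zify.
(** Only the graph N of closed neighbourhoods matters; since edges have at least
    three vertices, every pair of adjacent vertices lies in a triangle.  Give an
    undominated ("white") vertex weight 15, and a dominated ("blue") vertex with
    k white neighbours weight 0 if k = 0 and 5 + min(k, 4) otherwise.  Initially
    the total weight is 15n, so it suffices that Dominator can always move so
    that this move costs at least 27, and together with any reply of Staller at
    least 54.  Dominator plays greedily on large white degrees of white or blue
    vertices.  While these degrees are large a reply of Staller costs at least
    12; once the white degrees of white vertices are at most m (m = 1, 2) and
    those of blue vertices at most 4, it costs at least 17 - m. *)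
Set Implicit Arguments. Unset Strict Implicit. Unset Printing Implicit Defensive.

(** * Weight of a blue vertex as a function of its white degree *)

Definition bluewt (k : nat) : nat := if k is 0 then 0 else 5 + minn k 4.

Lemma bluewt_le9 k : bluewt k <= 9.
Proof. rewrite /bluewt; case: k => [|k] //; lia. Qed.

Lemma bluewt_leD k m : k <= m -> bluewt k <= 5 + m.
Proof. rewrite /bluewt; case: k => [|k] //; lia. Qed.

Lemma bluewt_mono k m : k <= m -> bluewt k <= bluewt m.
Proof. rewrite /bluewt; case: k => [|k]; case: m => [|m] //; lia. Qed.

Lemma bluewt_ge6 k : 0 < k -> 6 <= bluewt k.
Proof. rewrite /bluewt; case: k => [|k] //; lia. Qed.

(** Below the cap 4 each lost white neighbour costs one unit; losing the last one costs 5 more,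
    since the weight jumps from 6 to 0. *)
Lemma bluewt_drop k j :
  k + j <= 4 -> bluewt k + j + 5 * ((0 < k + j) && (k == 0)) <= bluewt (k + j).
Proof. by rewrite /bluewt; case: k => [|k]; case: j => [|j] //=; lia. Qed.

(** * Lower bounds for sums by few terms *)

Section SumBounds.
Variables (I : finType) (A : {set I}) (F : I -> nat).

Lemma leq_sum1 x : x \in A -> F x <= \sum_(i in A) F i.
Proof. by move=> xA; rewrite (big_setD1 x) //= leq_addr. Qed.

Lemma leq_sum2 x y : x \in A -> y \in A -> x != y ->
  F x + F y <= \sum_(i in A) F i.
Proof.
move=> xA yA xy; rewrite (big_setD1 x) //= leq_add2l (big_setD1 y) /= ?leq_addr //.
by rewrite !inE eq_sym xy.
Qed.

Lemma leq_sum3 x y z : x \in A -> y \in A -> z \in A ->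
  x != y -> x != z -> y != z -> F x + F y + F z <= \sum_(i in A) F i.
Proof.
move=> xA yA zA xy xz yz; rewrite (big_setD1 x) //= -addnA leq_add2l.
rewrite (big_setD1 y) /=; last by rewrite !inE eq_sym xy.
by rewrite leq_add2l (big_setD1 z) /= ?leq_addr // !inE eq_sym yz eq_sym xz.
Qed.

Lemma leq_sum_cst c : (forall x, x \in A -> c <= F x) ->
  #|A| * c <= \sum_(i in A) F i.
Proof. by move=> cF; rewrite -sum_nat_const; apply: leq_sum. Qed.

End SumBounds.

(** * White degrees and the potential *)

Section Potential.
Variables (T : finType) (N : T -> {set T}).
Hypothesis N_refl : forall v, v \in N v.
Hypothesis N_sym : forall u v, (u \in N v) = (v \in N u).
Hypothesis N_triangle : forall u v, u \in N v -> u != v ->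
  exists z, [/\ z != u, z != v, z \in N v & z \in N u].
Hypothesis N_nonisolated : forall v, exists2 u, u != v & u \in N v.

Implicit Types (W : {set T}) (u v w x y z : T).

(** Throughout, [W] is the set of white vertices, so a move at [v] turns [W] into [W :\: N v]. *)
Definition nb W u : {set T} := (N u :\ u) :&: W.
Definition deg W u : nat := #|nb W u|.
Definition weight W u : nat := if u \in W then 15 else bluewt (deg W u).
Definition Phi W : nat := \sum_u weight W u.
(** For white [u] this is the number of blue neighbours, as [u] itself is removed with [W]. *)
Definition bdeg W u : nat := #|N u :\: W|.

Lemma in_nb W u x : (x \in nb W u) = [&& x != u, x \in N u & x \in W].
Proof. by rewrite !inE andbA. Qed.

Lemma nbD W v u : nb (W :\: N v) u = nb W u :\: N v.
Proof. by apply/setP => x; rewrite !inE; do !case: (_ \in _); case: eqP. Qed.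

Lemma degD W v u (A : {set T}) : A \subset nb W u -> A \subset N v ->
  deg (W :\: N v) u + #|A| <= deg W u.
Proof.
move=> Au Av; rewrite /deg nbD -(cardsID (N v) (nb W u)) addnC leq_add2r.
by apply: subset_leq_card; rewrite subsetI Au.
Qed.

Lemma degD_le W v u : deg (W :\: N v) u <= deg W u.
Proof. by have := degD (sub0set (nb W u)) (sub0set (N v)); rewrite cards0 addn0. Qed.

Lemma degD1 W v u x : x \in nb W u -> x \in N v -> deg (W :\: N v) u < deg W u.
Proof.
by move=> xu xv; have := @degD W v u [set x]; rewrite !sub1set cards1 addn1; apply.
Qed.

Lemma degD2 W v u x y : x \in nb W u -> x \in N v -> y \in nb W u -> y \in N v ->
  x != y -> deg (W :\: N v) u + 2 <= deg W u.
Proof.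
move=> xu xv yu yv xy; have := @degD W v u [set x; y].
by rewrite cards2 xy; apply; rewrite subUset !sub1set ?xu ?yu ?xv ?yv.
Qed.

Lemma degD_eq0 W v u : nb W u \subset N v -> deg (W :\: N v) u = 0.
Proof.
move=> s; have := degD (subxx (nb W u)) s; rewrite -/(deg W u); lia.
Qed.

Lemma degD_self W v : deg (W :\: N v) v = 0.
Proof. by apply: degD_eq0; apply/subsetP => x; rewrite in_nb => /and3P[]. Qed.

Lemma deg_gt0 W u x : x \in nb W u -> 0 < deg W u.
Proof. by move=> xu; apply/card_gt0P; exists x. Qed.

(** * Weight lost in one move *)

(** White vertices outside [N v] keep weight 15, so only newly dominated vertices and blue vertices
    contribute. *)
Lemma gain_split W v :
  Phi W = Phi (W :\: N v)
        + \sum_(x in N v :&: W) (15 - bluewt (deg (W :\: N v) x))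
        + \sum_(u in ~: W) (bluewt (deg W u) - bluewt (deg (W :\: N v) u)).
Proof.
rewrite /Phi [\sum_(x in _ :&: _) _]big_mkcond [\sum_(u in ~: _) _]big_mkcond.
rewrite -!big_split /=; apply: eq_bigr => u _; rewrite /weight !inE.
have := degD_le W v u => /bluewt_mono; have := bluewt_le9 (deg (W :\: N v) u).
by case: (u \in W); case: (u \in N v) => /=; lia.
Qed.

Lemma gain_white W v : v \in W ->
  Phi (W :\: N v) + 15 + \sum_(x in nb W v) (15 - bluewt (deg (W :\: N v) x))
    <= Phi W.
Proof.
move=> vW; rewrite (gain_split W v) [\sum_(x in N v :&: W) _](big_setD1 v) ?inE ?N_refl //= degD_self.
have -> : (N v :&: W) :\ v = nb W v by apply/setP => x; rewrite !inE andbA.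
rewrite /=; lia.
Qed.

Lemma gain_blue W v : v \notin W ->
  Phi (W :\: N v) + bluewt (deg W v)
    + \sum_(x in nb W v) (15 - bluewt (deg (W :\: N v) x)) <= Phi W.
Proof.
move=> vW; rewrite (gain_split W v) [\sum_(u in ~: W) _](big_setD1 v) ?inE //=.
rewrite degD_self subn0.
have -> : N v :&: W = nb W v.
  by apply/setP => x; rewrite !inE; case: eqP => // ->; rewrite (negPf vW) andbF.
by rewrite /=; lia.
Qed.

(* Double counting: the unit drop of a blue vertex for each newly dominated
   neighbour is charged to that neighbour. *)
Lemma gain_bdeg W v (K : {set T}) :
  (forall u, u \notin W -> deg W u <= 4) ->
  (forall u, u \in K -> [/\ u \notin W, 0 < deg W u & deg (W :\: N v) u = 0]) ->
  Phi (W :\: N v)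
    + \sum_(x in N v :&: W) (15 - bluewt (deg (W :\: N v) x) + bdeg W x)
    + 5 * #|K| <= Phi W.
Proof.
move=> d4 HK; rewrite big_split /= (gain_split W v) -!addnA !leq_add2l.
have -> : \sum_(x in N v :&: W) bdeg W x
        = \sum_(u in ~: W) #|nb W u :&: N v|.
  under eq_bigr => x _ do rewrite /bdeg -sum1_card.
  rewrite (exchange_big_dep (mem (~: W))) /=; last by move=> x u _; rewrite !inE => /andP[].
  apply: eq_bigr => u; rewrite inE => uW; rewrite -sum1_card; apply: eq_bigl => x.
  rewrite !inE uW (N_sym u x); case: (eqVneq x u) => [->|_] /=.
    by rewrite (negPf uW) andbF.
  by do !case: (_ \in _).
(* Vertices of [K] lose their last white neighbour and pay the extra 5 of [bluewt_drop]; all of them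
   are blue, so the sum fits the one over [~: W]. *)
rewrite mulnC -sum_nat_const [\sum_(u in K) _]big_mkcond.
have -> : \sum_u (if u \in K then 5 else 0) = \sum_(u in ~: W) (if u \in K then 5 else 0).
  rewrite [RHS]big_mkcond; apply: eq_bigr => u _; rewrite inE.
  by case: (boolP (u \in K)) => [/HK[-> //]|_]; rewrite if_same.
rewrite -big_split /=; apply: leq_sum => u; rewrite inE => uW.
have /= := cardsID (N v) (nb W u); rewrite -nbD -!/(deg _ _).
set j := #|_|; rewrite addnC => E.
have := @bluewt_drop (deg (W :\: N v) u) j; rewrite E => /(_ (d4 _ uW)).
by case: ifP => [/HK[_ -> ->]|_] /=; lia.
Qed.

Lemma gain_bdeg0 W v : (forall u, u \notin W -> deg W u <= 4) ->
  Phi (W :\: N v)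
    + \sum_(x in N v :&: W) (15 - bluewt (deg (W :\: N v) x) + bdeg W x) <= Phi W.
Proof.
move=> d4; have := @gain_bdeg W v set0 d4; rewrite cards0 addn0; apply => u.
by rewrite inE.
Qed.

Lemma gain_bdeg1 W v a : (forall u, u \notin W -> deg W u <= 4) ->
  a \notin W -> 0 < deg W a -> nb W a \subset N v ->
  Phi (W :\: N v)
    + \sum_(x in N v :&: W) (15 - bluewt (deg (W :\: N v) x) + bdeg W x) + 5
  <= Phi W.
Proof.
move=> d4 aW a0 s; have := @gain_bdeg W v [set a] d4; rewrite cards1; apply => u.
by rewrite inE => /eqP ->; split=> //; apply: degD_eq0.
Qed.

Lemma bdeg_ge1 W u x : x \in N u -> x \notin W -> 0 < bdeg W u.
Proof. by move=> xu xW; apply/card_gt0P; exists x; rewrite inE xW. Qed.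

Lemma bdeg_ge2 W u x y : x \in N u -> x \notin W -> y \in N u -> y \notin W ->
  x != y -> 1 < bdeg W u.
Proof.
move=> xu xW yu yW xy; apply/card_gt1P; exists x, y.
by split=> //; rewrite inE ?xW ?yW.
Qed.

(** * Cost of an arbitrary legal move *)

Definition bounded W m n :=
  (forall w, w \in W -> deg W w <= m) /\ (forall u, u \notin W -> deg W u <= n).

Lemma boundedD W v m n : m <= n -> bounded W m n -> bounded (W :\: N v) m n.
Proof.
move=> mn [Hm Hn]; split=> u uW'; apply: leq_trans (degD_le W v u) _.
  by apply: Hm; move: uW'; rewrite inE => /andP[].
by case: (boolP (u \in W)) => [/Hm|/Hn] // /leq_trans; apply.
Qed.

(** A white [v] loses all 15. A blue [v] loses at least 6, and a white neighbour drops from 15 to at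
    most 9. *)
Lemma move_ge12 W v : N v :&: W != set0 -> Phi (W :\: N v) + 12 <= Phi W.
Proof.
case/set0Pn=> w; rewrite inE => /andP[wv wW].
case: (boolP (v \in W)) => vW; first by have := gain_white vW; lia.
have wn : w \in nb W v.
  by rewrite in_nb wv wW !andbT; apply: contraNneq vW => <-.
have := gain_blue vW; have := bluewt_ge6 (deg_gt0 wn).
have := leq_sum1 (fun x => 15 - bluewt (deg (W :\: N v) x)) wn.
have := bluewt_le9 (deg (W :\: N v) w) => /=; lia.
Qed.

(** The two other vertices of a triangle at [v] cannot both be white. *)
Lemma bdeg_gt0_deg1 W v : v \in W -> deg W v <= 1 -> 0 < bdeg W v.
Proof.
move=> vW d1; have [u uv uN] := N_nonisolated v.
have [z [zu zv zN zNu]] := N_triangle uN uv.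
case: (boolP (u \in W)) => uW; last exact: bdeg_ge1 uN uW.
case: (boolP (z \in W)) => zW; last exact: bdeg_ge1 zN zW.
suff : 1 < deg W v by rewrite ltnNge d1.
by apply/card_gt1P; exists u, z; split=> //; rewrite ?in_nb ?uv ?zv ?uN ?zN // eq_sym.
Qed.

Lemma move_bounded W v m : bounded W m 4 -> 0 < m <= 2 ->
  N v :&: W != set0 -> Phi (W :\: N v) + (17 - m) <= Phi W.
Proof.
move=> [Hm H4] m12 /set0Pn[w wX]; have := wX; rewrite inE => /andP[wv wW].
pose F x := 15 - bluewt (deg (W :\: N v) x) + bdeg W x.
case: (boolP (v \in W)) => vW.
  have vX : v \in N v :&: W by rewrite inE N_refl.
  have := gain_bdeg0 v H4; have /= := leq_sum1 F vX.
  (* White degree 2 forces [m = 2], where 15 is enough; otherwise a blue neighbour supplies the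
     sixteenth unit. *)
  rewrite /F degD_self /=; case: (leqP (deg W v) 1) => [/(bdeg_gt0_deg1 vW)|]; first lia.
  have := Hm _ vW; lia.
have vw : v != w by apply: contraNneq vW => ->.
have wn : w \in nb W v by rewrite in_nb eq_sym vw wv.
have sv : nb W v \subset N v by apply/subsetP => x; rewrite in_nb => /and3P[].
have := gain_bdeg1 H4 vW (deg_gt0 wn) sv.
have vNw : v \in N w by rewrite N_sym.
have bw := leq_trans (degD_le W v w) (Hm _ wW).
have := bluewt_leD bw; have := @bluewt_le9 (deg (W :\: N v) w).
(* So far there are 5 from [v] and [10 - m] from [w]. A white [z] adds at least 6; a blue [z] is,
   next to [v], a second blue neighbour of [w], giving the missing 2. *)
have [z [zv zw zNw zNv]] := N_triangle vNw vw.
case: (boolP (z \in W)) => zW.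
  have zX : z \in N v :&: W by rewrite inE zNv.
  have wz : w != z by rewrite eq_sym.
  have /= := leq_sum2 F wX zX wz; have := bluewt_le9 (deg (W :\: N v) z).
  have := bdeg_ge1 vNw vW; rewrite /F; clear -m12; lia.
have /= := leq_sum1 F wX; have vz : v != z by rewrite eq_sym.
have := bdeg_ge2 vNw vW zNw zW vz; rewrite /F; clear -m12; lia.
Qed.

(** * Good moves of Dominator, and decoupled positions *)

(** The first bound serves when Dominator's move ends the game, the second a full round. Each move
    is charged 27 because 15/27 = 5/9. *)
Definition dominator_move W v :=
  [/\ N v :&: W != set0, Phi (W :\: N v) + 27 <= Phi W &
    forall v', N v' :&: (W :\: N v) != set0 ->
      Phi (W :\: N v :\: N v') + 54 <= Phi W].

Lemma dominator_moveI W v g s : N v :&: W != set0 -> Phi (W :\: N v) + g <= Phi W ->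
  (forall v', N v' :&: (W :\: N v) != set0 ->
     Phi (W :\: N v :\: N v') + s <= Phi (W :\: N v)) ->
  27 <= g -> 54 <= g + s -> dominator_move W v.
Proof. by move=> v0 gv sv g27 gs; split=> [||v' /sv]; lia. Qed.

Lemma legal W v w : w \in N v -> w \in W -> N v :&: W != set0.
Proof. by move=> wv wW; apply/set0Pn; exists w; rewrite inE wv. Qed.

(* Undominated vertices with a common closed neighbour can only be dominated
   simultaneously. *)
Definition decoupled W := forall w u, w \in W -> u \in N w -> N u :&: W = N w :&: W.

Lemma decoupledD W v : decoupled W -> decoupled (W :\: N v).
Proof.
move=> Q w u; rewrite inE => /andP[wv wW] uw; rewrite !setIDA.
by rewrite (Q w u).
Qed.

(** Take a newly dominated [w] and a triangle at [w]. All closed neighbours of [w] end with weight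
    0, so [w] loses 15 and the two other vertices at least 6 each: 15 + 6 + 6 = 27. *)
Lemma move_decoupled W v : decoupled W -> N v :&: W != set0 ->
  Phi (W :\: N v) + 27 <= Phi W.
Proof.
move=> Q /set0Pn[w]; rewrite inE => /andP[wv wW].
have d0 u : u \in N w -> deg (W :\: N v) u = 0.
  (* [N u], [N w] and [N v] meet [W] in the same set, so [u] keeps no white neighbour. *)
  move=> uw; apply: degD_eq0; apply/subsetP => x; rewrite in_nb => /and3P[_ xu xW].
  have vw : v \in N w by rewrite N_sym.
  have : x \in N u :&: W by rewrite inE xu.
  by rewrite (Q w u) // -(Q w v) // inE => /andP[].
have key u : u \in N w -> weight (W :\: N v) u + 6 <= weight W u.
  move=> uw; rewrite /weight d0 // !inE.
  case: (boolP (u \in W)) => uW.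
    suff -> : u \in N v by [].
    have : u \in N w :&: W by rewrite inE uw.
    by rewrite -(Q w v) ?inE => [/andP[]||] //; rewrite N_sym.
  rewrite andbF /= add0n; apply: (@bluewt_ge6); apply: (@deg_gt0 _ _ w).
  by rewrite in_nb N_sym uw wW !andbT; apply: contraNneq uW => <-.
have [u uw uN] := N_nonisolated w; have [z [zu zw zN _]] := N_triangle uN uw.
have kw : weight (W :\: N v) w + 15 <= weight W w.
  by rewrite /weight d0 // !inE wW wv.
have mono x : weight (W :\: N v) x <= weight W x.
  rewrite /weight !inE; have := bluewt_mono (degD_le W v x).
  have := bluewt_le9 (deg (W :\: N v) x); by case: (x \in W); case: (x \in N v) => /=; lia.
have E : Phi W = Phi (W :\: N v)
               + \sum_(x in [set: T]) (weight W x - weight (W :\: N v) x).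
  under [X in _ + X]eq_bigl do rewrite inE.
  by rewrite /Phi -big_split; apply: eq_bigr => x _; rewrite /= subnKC.
have := key _ uN; have := key _ zN; rewrite E.
have wu : w != u by rewrite eq_sym.
have wz : w != z by rewrite eq_sym.
have uz : u != z by rewrite eq_sym.
have := @leq_sum3 _ [set: T] (fun x => weight W x - weight (W :\: N v) x) w u z.
rewrite !inE => /(_ isT isT isT wu wz uz).
move: kw; clear; lia.
Qed.

Lemma strategy_decoupled W : W != set0 -> decoupled W -> exists v, dominator_move W v.
Proof.
move=> /set0Pn[w wW] Q; exists w.
have lw := legal (N_refl w) wW.
apply: (dominator_moveI (g := 27) (s := 27)) => //; first exact: move_decoupled.
by move=> v'; apply: move_decoupled; apply: decoupledD.
Qed.

(** * Greedy moves at large white degrees *)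

(** [v] loses 15 and each white neighbour at least 15 - 9, so 45 = 15 + 5 * 6. *)
Lemma strategy_white5 W v : v \in W -> 5 <= deg W v -> dominator_move W v.
Proof.
move=> vW dv; apply: (dominator_moveI (g := 45) (s := 12)) => //.
- exact: legal (N_refl v) vW.
- have := gain_white vW.
  have := @leq_sum_cst _ (nb W v) (fun x => 15 - bluewt (deg (W :\: N v) x)) 6.
  have h x : x \in nb W v -> 6 <= 15 - bluewt (deg (W :\: N v) x).
    by move=> _; have := bluewt_le9 (deg (W :\: N v) x); lia.
  move=> /(_ h); rewrite -/(deg W v); nia.
- by move=> v'; apply: move_ge12.
Qed.

(** Each white neighbour also loses its white neighbour [v], so it keeps weight at most 8, and 43 =
    15 + 4 * 7. *)
Lemma strategy_white4 W v : (forall w, w \in W -> deg W w <= 4) ->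
  v \in W -> deg W v = 4 -> dominator_move W v.
Proof.
move=> H4 vW dv; apply: (dominator_moveI (g := 43) (s := 12)) => //.
- exact: legal (N_refl v) vW.
- have := gain_white vW.
  have := @leq_sum_cst _ (nb W v) (fun x => 15 - bluewt (deg (W :\: N v) x)) 7.
  have h x : x \in nb W v -> 7 <= 15 - bluewt (deg (W :\: N v) x).
    rewrite in_nb => /and3P[xv xN xW].
    have vx : v \in nb W x by rewrite in_nb eq_sym xv N_sym xN vW.
    have lt := leq_trans (degD1 vx (N_refl v)) (H4 _ xW).
    have /bluewt_leD : deg (W :\: N v) x <= 3 by [].
    lia.
  move=> /(_ h); rewrite -/(deg W v) dv; lia.
- by move=> v'; apply: move_ge12.
Qed.

Lemma legal_deg W v : 0 < deg W v -> N v :&: W != set0.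
Proof. by case/card_gt0P => x; rewrite in_nb => /and3P[_ xv]; apply: legal. Qed.

Lemma bluewt_degD W v x m : deg W x <= m ->
  15 - (5 + m) <= 15 - bluewt (deg (W :\: N v) x).
Proof.
move=> d; apply: leq_sub2l; apply: bluewt_leD.
exact: leq_trans (degD_le W v x) d.
Qed.

(** Here [v] only brings 9, but white degrees at most 3 leave weight at most 8: 44 = 9 + 5 * 7. *)
Lemma strategy_blue5 W v : (forall w, w \in W -> deg W w <= 3) ->
  v \notin W -> 5 <= deg W v -> dominator_move W v.
Proof.
move=> H3 vW dv; apply: (dominator_moveI (g := 44) (s := 12)) => //.
- by apply: legal_deg; lia.
- have := gain_blue vW.
  have -> : bluewt (deg W v) = 9 by rewrite /bluewt; case: (deg W v) dv => //; lia.
  have := @leq_sum_cst _ (nb W v) (fun x => 15 - bluewt (deg (W :\: N v) x)) 7.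
  have h x : x \in nb W v -> 7 <= 15 - bluewt (deg (W :\: N v) x).
    by move=> xn; apply: (@bluewt_degD _ _ _ 3); move: xn; rewrite in_nb => /and3P[_ _ /H3].
  move=> /(_ h); rewrite -/(deg W v); clear -dv; lia.
- by move=> v'; apply: move_ge12.
Qed.

(** The cost is 41 = 9 + 4 * 8; a reply costs 15 by [move_bounded] with [m = 2], as 12 would not
    do. *)
Lemma strategy_blue4 W v : bounded W 2 4 ->
  v \notin W -> deg W v = 4 -> dominator_move W v.
Proof.
move=> B vW dv; apply: (dominator_moveI (g := 41) (s := 15)) => //.
- by apply: legal_deg; rewrite dv.
- have := gain_blue vW.
  have := @leq_sum_cst _ (nb W v) (fun x => 15 - bluewt (deg (W :\: N v) x)) 8.
  have h x : x \in nb W v -> 8 <= 15 - bluewt (deg (W :\: N v) x).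
    by move=> xn; apply: (@bluewt_degD _ _ _ 2); move: xn; rewrite in_nb => /and3P[_ _]; case: B => + _; apply.
  move=> /(_ h); rewrite -/(deg W v) dv; clear; rewrite /bluewt; lia.
- by move=> v'; apply: (@move_bounded _ _ 2) => //; apply: boundedD.
Qed.

Lemma strategy_white3 W v : bounded W 3 4 ->
  v \in W -> deg W v = 3 -> dominator_move W v.
Proof.
move=> [H3 H4] vW dv; apply: (dominator_moveI (g := 42) (s := 12)) => //.
- exact: legal (N_refl v) vW.
- pose F x := 15 - bluewt (deg (W :\: N v) x) + bdeg W x.
  have := gain_bdeg0 v H4; rewrite (big_setD1 v) ?inE ?N_refl //= degD_self.
  have -> : (N v :&: W) :\ v = nb W v by apply/setP => x; rewrite !inE andbA.
  have := @leq_sum_cst _ (nb W v) F 9.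
  (* Let [z] complete a triangle on [v] and [x]. If [z] is white, [x] loses two white neighbours and
     keeps at most 6; if blue, [x] keeps at most 7 and [z] adds 1. Then 15 + 3 * 9 = 42. *)
  have h x : x \in nb W v -> 9 <= F x.
    rewrite in_nb => /and3P[xv xN xW].
    have vx : v \in nb W x by rewrite in_nb eq_sym xv N_sym xN vW.
    have d3 := H3 _ xW.
    have [z [zx zv zN zNx]] := N_triangle xN xv.
    case: (boolP (z \in W)) => zW.
      have zx' : z \in nb W x by rewrite in_nb zx zNx zW.
      have vz : v != z by rewrite eq_sym.
      have := degD2 vx (N_refl v) zx' zN vz.
      move: d3; rewrite /F; clear.
      case: (leqP (deg (W :\: N v) x) 1) => [/bluewt_leD|]; lia.
    have := bdeg_ge1 zNx zW.
    have := degD1 vx (N_refl v); move: d3; rewrite /F; clear.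
    case: (leqP (deg (W :\: N v) x) 2) => [/bluewt_leD|]; lia.
  move=> /(_ h); rewrite -/(deg W v) dv /F; clear; rewrite /=; lia.
- by move=> v'; apply: move_ge12.
Qed.

(** * White vertices of white degree at most 2 *)

Lemma boundedW m n n' W : n <= n' -> bounded W m n -> bounded W m n'.
Proof. by move=> nn [Hm Hn]; split=> // u /Hn/leq_trans; apply. Qed.

(** Any reply costs at least [17 - m], which completes [37 + m] to 54. *)
Lemma dominator_move_bounded W v m : bounded W m 4 -> 0 < m <= 2 ->
  N v :&: W != set0 -> Phi (W :\: N v) + (37 + m) <= Phi W -> dominator_move W v.
Proof.
move=> B m12 lv gv; apply: (dominator_moveI (g := 37 + m) (s := 17 - m)) => //; try lia.
move=> v'; apply: (@move_bounded _ _ m) => //; apply: boundedD => //; lia.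
Qed.

Lemma nb_sym W v x : v \in W -> x \in nb W v -> v \in nb W x.
Proof. by move=> vW; rewrite !in_nb eq_sym N_sym vW => /and3P[-> ->]. Qed.

Lemma nb_in W v x : x \in nb W v -> x \in N v :&: W.
Proof. by rewrite in_nb inE => /andP[]. Qed.

Lemma nb_blue W a x : a \notin W -> x \in N a -> x \in W -> x \in nb W a.
Proof.
by move=> aW xa xW; rewrite in_nb xa xW !andbT; apply: contraNneq aW => <-.
Qed.

(** The three white vertices have no further white neighbours, so all end at weight 0: 45 units. *)
Lemma strategy_triangle W v x y : bounded W 2 3 -> v \in W ->
  x \in nb W v -> y \in nb W v -> x != y -> y \in N x -> dominator_move W v.
Proof.
move=> B vW xn yn xy yNx.
have B4 : bounded W 2 4 by apply: boundedW B.
apply: (dominator_move_bounded B4) => //; first exact: legal (N_refl v) vW.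
have [yv yN yW] : [/\ y != v, y \in N v & y \in W] by apply/and3P; rewrite -in_nb.
have [xv xN xW] : [/\ x != v, x \in N v & x \in W] by apply/and3P; rewrite -in_nb.
have Dx : deg (W :\: N v) x = 0.
  have yx : y \in nb W x by rewrite in_nb eq_sym xy yNx yW.
  have vy : v != y by rewrite eq_sym.
  have := degD2 (nb_sym vW xn) (N_refl v) yx yN vy.
  by have := B4.1 _ xW; clear; lia.
have Dy : deg (W :\: N v) y = 0.
  have xy' : x \in nb W y by rewrite in_nb xy N_sym yNx xW.
  have vx : v != x by rewrite eq_sym.
  have := degD2 (nb_sym vW yn) (N_refl v) xy' xN vx.
  by have := B4.1 _ yW; clear; lia.
have := gain_white vW.
have /= := leq_sum2 (fun x => 15 - bluewt (deg (W :\: N v) x)) xn yn xy.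
rewrite Dx Dy; clear; rewrite /=; lia.
Qed.

(** The white degree bound 3 makes [v], [x], [y] the only white neighbours of [a], which therefore
    yields the extra 5: 16 + 10 + 10 + 5 = 41. *)
Lemma strategy_apex W v x y a : bounded W 2 3 -> v \in W ->
  x \in nb W v -> y \in nb W v -> x != y ->
  a \notin W -> a \in N v -> a \in N x -> a \in N y -> dominator_move W v.
Proof.
move=> B vW xn yn xy aW av ax ay.
have B4 : bounded W 2 4 by apply: boundedW B.
apply: (dominator_move_bounded B4) => //; first exact: legal (N_refl v) vW.
have [yv yN yW] : [/\ y != v, y \in N v & y \in W] by apply/and3P; rewrite -in_nb.
have [xv xN xW] : [/\ x != v, x \in N v & x \in W] by apply/and3P; rewrite -in_nb.
have vx : v != x by rewrite eq_sym.
have vy : v != y by rewrite eq_sym.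
have va : v \in nb W a by apply: nb_blue => //; rewrite N_sym.
have sa : nb W a \subset N v.
  have sub : v |: [set x; y] \subset nb W a.
    rewrite !subUset !sub1set va /=.
    by rewrite !nb_blue // N_sym.
  have/eqP <- : v |: [set x; y] == nb W a.
    rewrite eqEcard sub /= cardsU1 cards2 xy !inE negb_or vx vy /=.
    exact: B.2 _ aW.
  by rewrite !subUset !sub1set N_refl xN.
have := gain_bdeg1 B4.2 aW (deg_gt0 va) sa.
pose F x := 15 - bluewt (deg (W :\: N v) x) + bdeg W x.
have vX : v \in N v :&: W by rewrite inE N_refl.
have := leq_sum3 F vX (nb_in xn) (nb_in yn) vx vy xy; rewrite /F degD_self.
have := bdeg_ge1 av aW; have := bdeg_ge1 ax aW; have := bdeg_ge1 ay aW.
have h z : z \in nb W v -> bluewt (deg (W :\: N v) z) <= 6.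
  move=> zn; have := degD1 (nb_sym vW zn) (N_refl v).
  move: zn; rewrite in_nb => /and3P[_ _ /B4.1]; clear => d2 d1.
  by apply: (@bluewt_leD _ 1); lia.
by move: (h _ xn) (h _ yn); clear; rewrite /=; lia.
Qed.

Lemma strategy_white2 W v : bounded W 2 3 -> v \in W -> deg W v = 2 ->
  exists v', dominator_move W v'.
Proof.
move=> B vW dv.
(* The triples covered by [strategy_triangle] or [strategy_apex]. Without them, white neighbours
   always share a blue neighbour, and those obtained from two white neighbours of the same [w]
   differ. *)
pose close w x y := [&& x \in nb W w, y \in nb W w, x != y &
  (y \in N x) || [exists a, [&& a \notin W, a \in N w, a \in N x & a \in N y]]].
case: (boolP [exists w in W, exists x, exists y, close w x y]) => [|far].
  case/exists_inP=> w wW /existsP[x /existsP[y /and4P[xn yn xy]]].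
  case/orP=> [yx|/existsP[a /and4P[aW aw ax ay]]]; exists w.
    exact: (strategy_triangle B wW xn yn).
  exact: (strategy_apex B wW xn yn xy aW).
have {}far w x y : w \in W -> close w x y = false.
  move=> wW; apply/negP => c; move/negP: far; apply.
  by apply/exists_inP; exists w => //; apply/existsP; exists x; apply/existsP; exists y.
have third w x : w \in W -> x \in nb W w ->
    exists z, [/\ z \notin W, z \in N w & z \in N x].
  move=> wW xn; have := xn; rewrite in_nb => /and3P[xw xN xW].
  have [z [zx zw zN zNx]] := N_triangle xN xw.
  exists z; split=> //; apply/negP => zW.
  have /negP := negbT (far w x z wW); apply.
  by rewrite /close xn in_nb zw zN zW eq_sym zx zNx.
have bd2 w : w \in W -> 1 < deg W w -> 1 < bdeg W w.
  move=> wW /card_gt1P[x [y [xn yn xy]]].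
  have [a [aW aw ax]] := third w x wW xn; have [b [bW bw by']] := third w y wW yn.
  apply: (bdeg_ge2 aw aW bw bW); apply: contraFneq (far w x y wW) => ab.
  rewrite /close xn yn xy /=; apply/orP; right; apply/existsP; exists a.
  by rewrite aW aw ax ab.
have B4 : bounded W 2 4 by apply: boundedW B.
exists v; apply: (dominator_move_bounded B4) => //; first exact: legal (N_refl v) vW.
have := gain_bdeg0 v B4.2; rewrite (big_setD1 v) ?inE ?N_refl //= degD_self.
have -> : (N v :&: W) :\ v = nb W v by apply/setP => x; rewrite !inE andbA.
pose F x := 15 - bluewt (deg (W :\: N v) x) + bdeg W x.
(* White degree 2 gives 9 plus two blue neighbours, white degree 1 gives 15 plus one. With 15 + 2
   from [v] the total is 39. *)
have h x : x \in nb W v -> 11 <= F x.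
  move=> xn; have := xn; rewrite in_nb => /and3P[_ _ xW].
  have d1 := degD1 (nb_sym vW xn) (N_refl v); have d2 := B4.1 _ xW.
  have [a [aW av ax]] := third v x vW xn; have b1 := bdeg_ge1 ax aW.
  rewrite /F; case: (ltnP 1 (deg W x)) => d.
    have := bd2 _ xW d; have : bluewt (deg (W :\: N v) x) <= 6.
      by move: d1 d2; clear => d1 d2; apply: (@bluewt_leD _ 1); lia.
    by clear; lia.
  have -> : deg (W :\: N v) x = 0 by move: d d1; clear; lia.
  by move: b1; clear; rewrite /=; lia.
have := leq_sum_cst h; rewrite -/(deg W v) dv.
have : 1 < bdeg W v by apply: bd2; rewrite ?dv.
by rewrite /F; clear; rewrite /=; lia.
Qed.

(** * White vertices of white degree at most 1 *)

Lemma pair_white W w v : w \in W -> deg W w <= 1 -> v \in nb W w ->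
  N w :&: W = [set w; v].
Proof.
move=> wW d1 vn; have := vn; rewrite in_nb => /and3P[vw vN vW].
have sv : [set v] \subset nb W w by rewrite sub1set.
have /eqP E : [set v] == nb W w by rewrite eqEcard sv cards1.
apply/setP => x; move/setP/(_ x): E; rewrite !inE.
by case: (eqVneq x w) => [->|_] /= e; rewrite ?N_refl ?wW // e.
Qed.

Lemma strategy_pair W v w u : bounded W 1 3 -> w \in W -> v \in nb W w ->
  u \notin W -> u \in N w -> N u :&: W != N w :&: W ->
  exists v', dominator_move W v'.
Proof.
move=> B wW vn uW uN; rewrite (pair_white wW (B.1 _ wW) vn) => Nu.
have B4 : bounded W 1 4 by apply: boundedW B.
have := vn; rewrite in_nb => /and3P[vw vN vW].
have wv : w != v by rewrite eq_sym.
have [a [av aw aNw aNv]] := N_triangle vN vw.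
have aW : a \notin W.
  apply/negP => aW; have := B.1 _ wW; rewrite leqNgt => /negP; apply.
  by apply/card_gt1P; exists a, v; split=> //; rewrite in_nb aw aNw aW.
have van : v \in nb W a by apply: nb_blue => //; rewrite N_sym.
have wan : w \in nb W a by apply: nb_blue => //; rewrite N_sym.
have bw := bdeg_ge1 aNw aW; have bv := bdeg_ge1 aNv aW.
(* If [a] sees no other white vertex, [u] and [a] are distinct blue neighbours of [w], and playing
   [w] costs 17 + 16 + 5 = 38. Otherwise playing [a] costs at least 16 + 16 + 10 + 5. *)
case: (boolP (nb W a \subset [set w; v])) => [sa|/subsetPn[z zn]].
  have ua : u != a.
    apply: contraNneq Nu => ->; rewrite eqEsubset; apply/andP; split; last first.
      by rewrite subUset !sub1set !nb_in.
    apply/subsetP => x; rewrite inE => /andP[xa xW].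
    by apply: (subsetP sa); apply: nb_blue.
  exists w; apply: (dominator_move_bounded B4) => //; first exact: legal (N_refl w) wW.
  have sNw : [set w; v] \subset N w by rewrite subUset !sub1set N_refl.
  have := gain_bdeg1 B4.2 aW (deg_gt0 van) (subset_trans sa sNw).
  pose F x := 15 - bluewt (deg (W :\: N w) x) + bdeg W x.
  have wX : w \in N w :&: W by rewrite inE N_refl.
  have := leq_sum2 F wX (nb_in vn) wv; rewrite /F degD_self.
  have -> : deg (W :\: N w) v = 0.
    have := degD1 (nb_sym wW vn) (N_refl w).
    by have := B.1 _ vW; clear; lia.
  have := bdeg_ge2 uN uW aNw aW ua.
  by move: bv; clear; rewrite /=; lia.
rewrite !inE negb_or => /andP[zw zv].
have := zn; rewrite in_nb => /and3P[_ zNa zW].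
have aNz : a \in N z by rewrite N_sym.
have bz := bdeg_ge1 aNz aW.
have wNa : w \in N a by rewrite N_sym.
exists a; apply: (dominator_move_bounded B4) => //; first exact: legal wNa wW.
have sa : nb W a \subset N a by apply/subsetP => x; rewrite in_nb => /and3P[].
have := gain_bdeg1 B4.2 aW (deg_gt0 van) sa.
pose F x := 15 - bluewt (deg (W :\: N a) x) + bdeg W x.
have wz : w != z by rewrite eq_sym.
have vz : v != z by rewrite eq_sym.
have := leq_sum3 F (nb_in wan) (nb_in van) (nb_in zn) wv wz vz.
have vNa : v \in N a by rewrite N_sym.
have Dw : deg (W :\: N a) w = 0.
  by have := degD1 vn vNa; have := B.1 _ wW; clear; lia.
have Dv : deg (W :\: N a) v = 0.
  by have := degD1 (nb_sym wW vn) wNa; have := B.1 _ vW; clear; lia.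
rewrite /F Dw Dv; have := bluewt_degD a (B.1 _ zW).
by move: bw bv bz; clear; rewrite /=; lia.
Qed.

Lemma bdeg_ge2_deg0 W z : deg W z = 0 -> 1 < bdeg W z.
Proof.
move=> dz; have [u uz uN] := N_nonisolated z.
have [t [tu tz tN _]] := N_triangle uN uz.
have blue x : x != z -> x \in N z -> x \notin W.
  move=> xz xN; apply/negP => xW; have : x \in nb W z by rewrite in_nb xz xN.
  by move/deg_gt0; rewrite dz.
have ut : u != t by rewrite eq_sym.
exact: (bdeg_ge2 uN (blue _ uz uN) tN (blue _ tz tN) ut).
Qed.

Lemma strategy_white1 W : bounded W 1 3 -> ~ decoupled W ->
  exists v, dominator_move W v.
Proof.
move=> B nQ.
have [w [u [wW uN Nu]]] : exists w u, [/\ w \in W, u \in N w & N u :&: W != N w :&: W].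
  case: (boolP [exists w in W, exists u in N w, N u :&: W != N w :&: W]).
    by case/exists_inP=> w wW /exists_inP[u uN Nu]; exists w, u.
  move=> n; case: nQ => w u wW uN; apply/eqP; apply/negPn/negP => Nu.
  move/negP: n; apply; apply/exists_inP; exists w => //.
  by apply/exists_inP; exists u.
have uw : u != w by apply: contraNneq Nu => ->.
have uW : u \notin W.
  apply/negP => uW; have un : u \in nb W w by rewrite in_nb uw uN.
  case/eqP: Nu; rewrite (pair_white wW (B.1 _ wW) un).
  by rewrite (pair_white uW (B.1 _ uW) (nb_sym wW un)) setUC.
(* A white neighbour of [w] leads to [strategy_pair]. Otherwise [u] has a second white neighbour
   [z], which is handled likewise; if [z] has no white neighbour either, playing [u] costs 17 + 17 +
   5 = 39. *)
case: (posnP (deg W w)) => [d0|/card_gt0P[v vn]]; last first.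
  exact: (strategy_pair B wW vn uW uN Nu).
have wNu : w \in N u by rewrite N_sym.
have wn := nb_blue uW wNu wW.
have solo x : x \notin nb W w.
  by apply/negP => /deg_gt0; rewrite d0.
have [z zw zn] : exists2 z, z != w & z \in nb W u.
  case: (boolP (nb W u \subset [set w])) => [s|/subsetPn[z zn]]; last first.
    by rewrite inE => zw; exists z.
  case/eqP: Nu; apply/setP => x; rewrite !inE.
  case: (boolP (x \in W)) => xW; last by rewrite !andbF.
  rewrite !andbT; case: (eqVneq x w) => [->|xw]; first by rewrite N_refl.
  have -> : x \in N u = false.
    apply/negP => /(nb_blue uW)/(_ xW)/(subsetP s); rewrite inE => /eqP xw'.
    by rewrite xw' eqxx in xw.
  by have := solo x; rewrite in_nb xw xW andbT => /negPf.
have := zn; rewrite in_nb => /and3P[_ zNu zW].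
case: (posnP (deg W z)) => [dz|/card_gt0P[y yn]]; last first.
  apply: (strategy_pair B zW yn uW); first by rewrite N_sym.
  apply/eqP => /setP/(_ w); rewrite !inE wNu wW !andbT => /esym wz.
  by have := solo z; rewrite in_nb zw zW N_sym wz.
have B4 : bounded W 1 4 by apply: boundedW B.
exists u; apply: (dominator_move_bounded B4) => //; first exact: legal wNu wW.
have su : nb W u \subset N u by apply/subsetP => x; rewrite in_nb => /and3P[].
have := gain_bdeg1 B4.2 uW (deg_gt0 wn) su.
pose F x := 15 - bluewt (deg (W :\: N u) x) + bdeg W x.
have := leq_sum2 F (nb_in zn) (nb_in wn) zw; rewrite /F.
have := degD_le W u w; have := degD_le W u z; rewrite d0 dz !leqn0 => /eqP -> /eqP ->.
have := bdeg_ge2_deg0 d0; have := bdeg_ge2_deg0 dz.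
by clear; rewrite /=; lia.
Qed.

(** * Combination of the cases *)

Lemma decoupled_dec W : {decoupled W} + {~ decoupled W}.
Proof.
case: (boolP [forall w in W, forall u in N w, N u :&: W == N w :&: W]) => H.
  by left=> w u wW uN; move/forall_inP: H => /(_ w wW)/forall_inP/(_ u uN)/eqP.
right=> Q; move/negP: H; apply; apply/forall_inP => w wW.
by apply/forall_inP => u uN; apply/eqP; apply: Q.
Qed.

Lemma eq_bound_or_lt (A : {set T}) (f : T -> nat) n :
  (forall v, v \in A -> f v <= n.+1) ->
  (exists2 v, v \in A & f v = n.+1) \/ (forall v, v \in A -> f v <= n).
Proof.
move=> H; case: (boolP [exists v in A, f v == n.+1]).
  by case/exists_inP=> v vA /eqP; left; exists v.
move=> n1; right=> v vA; have := H v vA; rewrite leq_eqVlt => /orP[e|//].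
by case/exists_inP: n1; exists v.
Qed.

(** The order of the cases matters: each one provides the degree bounds that the later ones
    assume. *)
Lemma strategy W : W != set0 -> exists v, dominator_move W v.
Proof.
move=> W0; case: (decoupled_dec W) => [|nQ]; first exact: strategy_decoupled.
case: (boolP [exists v in W, 4 < deg W v]) => [/exists_inP[v vW dv]|w5].
  by exists v; apply: strategy_white5.
have {w5} : forall w, w \in W -> deg W w <= 4.
  by move=> w wW; rewrite leqNgt; apply: contra w5 => ?; apply/exists_inP; exists w.
move=> H4; case: (eq_bound_or_lt H4) => [[v vW dv]|H3].
  by exists v; apply: strategy_white4.
case: (boolP [exists v in ~: W, 4 < deg W v]) => [/exists_inP[v vW dv]|w5].
  by exists v; apply: strategy_blue5 => //; rewrite inE in vW.
have {w5} : forall u, u \in ~: W -> deg W u <= 4.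
  by move=> w wW; rewrite leqNgt; apply: contra w5 => ?; apply/exists_inP; exists w.
move=> K4; have bK n : (forall u, u \in ~: W -> deg W u <= n) -> forall u, u \notin W -> deg W u <= n.
  by move=> K u uW; apply: K; rewrite inE.
case: (eq_bound_or_lt H3) => [[v vW dv]|H2].
  by exists v; apply: strategy_white3 => //; split=> //; apply: bK.
case: (eq_bound_or_lt K4) => [[v vW dv]|/bK K3].
  exists v; apply: strategy_blue4 => //; first by split=> //; apply: bK.
  by rewrite inE in vW.
case: (eq_bound_or_lt H2) => [[v vW dv]|H1].
  by apply: strategy_white2 vW dv.
exact: strategy_white1.
Qed.

End Potential.

(** * From the potential to the value of the game *)

Lemma bigmin_le (I : finType) (P : pred I) (F : I -> nat) n i :
  P i -> \big[minn/n]_(j | P j) F j <= F i.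
Proof.
move=> Pi; have : i \in index_enum I by rewrite mem_index_enum.
elim: (index_enum I) => [//|j r IH]; rewrite inE big_cons.
case/predU1P => [<-|/IH le]; first by rewrite Pi geq_minl.
by case: ifP => // _; rewrite geq_min le orbT.
Qed.

Theorem theorem5 (T : finType) (E : {set {set T}}) :
  (forall v : T, ~ isolated E v) ->
  (forall e, e \in E -> 3 <= #|e|) ->
  9 * game_domination_number E <= 5 * #|T|.
Proof.
move=> noiso size3.
have N_refl v : v \in cnbhd E v by rewrite inE eqxx.
have N_sym u v : (u \in cnbhd E v) = (v \in cnbhd E u).
  rewrite !inE eq_sym; congr (_ || _); apply: eq_existsb => e.
  by rewrite [(v \in e) && _]andbC.
have N_triangle u v : u \in cnbhd E v -> u != v ->
    exists z, [/\ z != u, z != v, z \in cnbhd E v & z \in cnbhd E u].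
  move=> + uv; rewrite inE (negPf uv) => /exists_inP[e eE /andP[ve ue]].
  have /subsetPn[z ze] : ~~ (e \subset [set u; v]).
    apply/negP => /subset_leq_card; rewrite cards2 uv => le2.
    by have := leq_trans (size3 e eE) le2.
  rewrite !inE negb_or => /andP[zu zv]; exists z; split=> //; rewrite inE.
    by apply/orP; right; apply/exists_inP; exists e; rewrite ?ve.
  by apply/orP; right; apply/exists_inP; exists e; rewrite ?ue.
have N_nonisolated v : exists2 u, u != v & u \in cnbhd E v.
  case: (boolP [exists u, (u != v) && (u \in cnbhd E v)]).
    by case/existsP=> u /andP[]; exists u.
  move=> iso; case: (noiso v) => u uv; apply: contra iso => uN.
  by apply/existsP; exists u; rewrite uv.
have legalE v (U : {set T}) : ~~ (cnbhd E v \subset U) = (cnbhd E v :&: ~: U != set0).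
  by rewrite -setDE setD_eq0.
have DU v (U : {set T}) : ~: (U :|: cnbhd E v) = ~: U :\: cnbhd E v by rewrite setCU setDE.
(* A round uses two units of fuel, so the induction carries two consecutive values of [k]. *)
have value k : (forall U, 27 * game_value E k true U <= Phi (cnbhd E) (~: U)) /\
               (forall U, 27 * game_value E k.+1 true U <= Phi (cnbhd E) (~: U)).
  elim: k => [|k [IH0 IH1]]; split=> // U; rewrite [game_value _ _.+1 _ _]/=.
  - case: eqP => // /eqP UT.
    have W0 : ~: U != set0 by rewrite -setCT (inj_eq (@setC_inj T)).
    have [v [lv gv _]] := strategy N_refl N_sym N_triangle N_nonisolated W0.
    have := @bigmin_le _ (fun v => ~~ (cnbhd E v \subset U)) (fun _ => 0) #|T|.+1 v.
    by rewrite legalE leqn0 => /(_ lv)/eqP ->; move: gv; clear; lia.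
  - case: eqP => // /eqP UT.
    have W0 : ~: U != set0 by rewrite -setCT (inj_eq (@setC_inj T)).
    have [v [lv gv sv]] := strategy N_refl N_sym N_triangle N_nonisolated W0.
    set F := (F in \big[minn/_]_(i | _) F i).
    apply: (@leq_trans (27 * (F v).+1)).
      by rewrite leq_mul2l ltnS bigmin_le ?orbT // legalE.
    rewrite /F; case: eqP => [_|/eqP U1T].
      by move: gv; clear; lia.
    set m := \max_(_ | _) _; suff : 27 * m + 54 <= Phi (cnbhd E) (~: U) by clear; lia.
    (* A vertex not yet dominated is a legal reply, so the maximum is attained by some move [v']. *)
    have [w wU] : exists w, w \notin U :|: cnbhd E v.
      apply/existsP; apply: contraR U1T => /existsPn all_in.
      by apply/eqP/setP => w; rewrite [RHS]inE; apply/negPn/all_in.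
    have : 0 < #|[pred v' | ~~ (cnbhd E v' \subset U :|: cnbhd E v)]|.
      by apply/card_gt0P; exists w; rewrite inE; apply/subsetPn; exists w.
    case/(eq_bigmax_cond (fun v' => game_value E k true (U :|: cnbhd E v :|: cnbhd E v'))) => v'.
    rewrite inE legalE DU => /sv; rewrite -!DU => gv' mE.
    have -> : m = game_value E k true (U :|: cnbhd E v :|: cnbhd E v') by rewrite -mE.
    by apply: leq_trans gv'; rewrite leq_add2r IH0.
have [/(_ set0)] := value #|T|; rewrite -/(game_domination_number E) setC0 => + _.
(* Initially all vertices are white, so 27 times the game value is at most 15n; dividing by 3 gives
   the claim. *)
have -> : Phi (cnbhd E) setT = #|T| * 15.
  by rewrite /Phi -sum_nat_const; apply: eq_bigr => u _; rewrite /weight inE.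
by clear; lia.
Qed.
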